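(* For every $H\in(0,1]$ there exists a positive number $\alpha_H>0$ such that \[ E\, e^{\delta |\zeta_H|^{2H}}<\infty \quad\text{for all } \delta<\alpha_H . \]
   Context: Let $H\in(0,1]$ and let $W^H=\{W^H_s,\ s\in\mathbb{R}\}$ be a two-sided fractional Brownian motion with Hurst parameter $H$: a centered Gaussian process with continuous trajectories, $W^H_0=0$, $E(W^H_s)=0$ and $E|W^H_s-W^H_t|^2=|s-t|^{2H}$ for all $s,t\in\mathbb{R}$ (so its covariance is $R(t,s)=\frac12(|t|^{2H}+|s|^{2H}-|t-s|^{2H})$). Define $Z_t=\exp\{W^H_t-\tfrac12|t|^{2H}\}$ for $t\in\mathbb{R}$, the random density $q_t=Z_t\left(\int_{-\infty}^{\infty}Z_u\,du\right)^{-1}$, and the Pitman-type random variable $\zeta_H=\int_{-\infty}^{\infty} t\,q_t\,dt$. *)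

(* Defs.v *)
From HB Require Import structures.
From mathcomp Require Import all_boot all_order all_algebra.
From mathcomp Require Import all_classical all_reals all_analysis.
Set Implicit Arguments. Unset Strict Implicit. Unset Printing Implicit Defensive.
Import Order.TTheory GRing.Theory Num.Theory.
Import numFieldNormedType.Exports.
Local Open Scope classical_set_scope.
Local Open Scope ring_scope.

(* A real random variable X is Gaussian with mean m and standard deviation s
   (s = 0 : degenerate law, the Dirac mass at m). *)
Definition is_gaussian_rv {R : realType} {d} {T : measurableType d}
    (P : probability T R) (X : T -> R) : Prop :=
  exists (m s : R),
    forall A : set R, measurable A ->
      P (X @^-1` A) = (if s == 0 then \d_m A else normal_prob m s A).

Definition is_two_sided_fBm {R : realType} {d} {T : measurableType d}
    (P : probability T R) (H : R) (W : R -> T -> R) : Prop :=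
  (forall s, measurable_fun [set: T] (W s)) /\
  (forall (n : nat) (t : 'I_n -> R) (a : 'I_n -> R),
      is_gaussian_rv P (fun w => \sum_(i < n) a i * W (t i) w)) /\
  (forall w, continuous (fun s => W s w)) /\
  (forall w, W 0 w = 0) /\
  (forall s, P.-integrable [set: T] (fun w => (W s w)%:E) /\
             (\int[P]_w (W s w)%:E = 0)%E) /\
  (forall s t, (\int[P]_w ((W s w - W t w) ^+ 2)%:E = (`|s - t| `^ (2 * H))%:E)%E).

Definition fbm_Z {R : realType} {T : Type} (H : R) (W : R -> T -> R)
    (t : R) (w : T) : R :=
  expR (W t w - `|t| `^ (2 * H) / 2).

Definition fbm_q {R : realType} {T : Type} (H : R) (W : R -> T -> R)
    (t : R) (w : T) : R :=
  fbm_Z H W t w / Rintegral (@lebesgue_measure R) [set: R] (fun u => fbm_Z H W u w).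

Definition pitman_zeta {R : realType} {T : Type} (H : R) (W : R -> T -> R)
    (w : T) : R :=
  Rintegral (@lebesgue_measure R) [set: R] (fun t => t * fbm_q H W t w).

(* Main.v *)
Require Import Defs.
From HB Require Import structures.
From mathcomp Require Import all_boot all_order all_algebra.
From mathcomp Require Import all_classical all_reals all_analysis.
From mathcomp Require Import measurable_realfun ring lra.
Import Order.TTheory GRing.Theory Num.Theory.
Import numFieldNormedType.Exports.
Local Open Scope classical_set_scope.
Local Open Scope ring_scope.

(** Put p = 2H and c = \int Z. For s in [0,1] let u be the point at distance s
    from 0 towards t, and v the point at distance s from t towards 0. Since
    1/y >= 2/c - y/c^2 and sqrt (Z_u Z_v) <= (Z_u + Z_v)/2, whose integral over s
    is at most c, we get q_t <= \int_0^1 Z_t / sqrt (Z_u Z_v) ds. The integrand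
    is the exponential of a Gaussian variable, namely W_t - (W_u + W_v)/2, minus
    about |t|^p / 4; the variance is about |t|^p / 4, up to a factor 3/2 that
    absorbs the cross term, so E q_t = O(exp (- |t|^p / 16)). As zeta is the mean of
    q, either |zeta| < 2 or exp (a |zeta|^p) <= \int |t| exp (4 a |t|^p) q_t dt,
    whose expectation is finite for a = 1/128. *)

(** * Comparison of integrals of nonnegative functions *)

Section lower_integral.
Local Open Scope ereal_scope.
Context {d} {T : measurableType d} {R : realType}.
Variable mu : {measure set T -> \bar R}.

(* The integral of a nonnegative function is a supremum over simple functions below it,
   so no measurability is needed: that of [pitman_zeta] is never established. *)
Lemma ge0_le_lower_integral (D : set T) (f g : T -> \bar R) :
  (forall x, D x -> 0 <= f x) -> (forall x, D x -> f x <= g x) ->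
  \int[mu]_(x in D) f x <= \int[mu]_(x in D) g x.
Proof.
move=> f0 fg.
have g0 x : D x -> 0 <= g x by move=> Dx; exact: le_trans (f0 x Dx) (fg x Dx).
rewrite !ge0_integralE//; apply: le_ereal_sup => _ [h /= hf <-].
exists h => // x; apply: le_trans (hf x) _; exact: lee_restrict.
Qed.

End lower_integral.

(** * Translations and reflections of Lebesgue measure *)

Section translation.
Local Open Scope ereal_scope.
Context {R : realType}.
Local Notation mu := (@lebesgue_measure R).

(** Lebesgue measure is determined by its values on half-open intervals, and a translation keeps
    their length. *)
Lemma lebesgue_measureD (a : R) (A : set R) : measurable A ->
  pushforward mu (+%R a : _ -> measurableTypeR R) A = mu A.
Proof.
move=> mA.
have ma : measurable_fun setT (+%R a : measurableTypeR R -> measurableTypeR R).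
  by apply: measurable_funD.
apply/esym/lebesgue_measure_unique => //= _ [[x y]] _ <-.
rewrite /pushforward.
rewrite [X in _ = _ X](_ : _ = `](x - a)%R, (y - a)%R]%classic); last first.
  apply/seteqP; split => z /=; rewrite !in_itv/= ltrBlDl lerBrDl//.
rewrite !lebesgue_measure_itv/= !lte_fin ltrD2r.
by case: ifP => // _; rewrite -!EFinD; congr EFin; ring.
Qed.

Lemma ge0_integral_translation (a : R) (f : R -> \bar R) :
  measurable_fun setT f -> (forall x, 0 <= f x) ->
  \int[mu]_x f (a + x)%R = \int[mu]_x f x.
Proof.
move=> mf f0.
have ma : measurable_fun setT (+%R a : measurableTypeR R -> measurableTypeR R).
  by apply: measurable_funD.
transitivity (\int[pushforward mu (+%R a : measurableTypeR R -> measurableTypeR R)]_x f x).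
  by rewrite ge0_integral_pushforward.
by apply: eq_measure_integral => //= A mA _; exact: lebesgue_measureD.
Qed.

Lemma ge0_integral_reflection (a : R) (f : R -> \bar R) :
  measurable_fun setT f -> (forall x, 0 <= f x) ->
  \int[mu]_x f (a - x)%R = \int[mu]_x f x.
Proof.
move=> mf f0; rewrite -(@ge0_integral_translation a f)//.
have mfa : measurable_fun setT (fun x => f (a + x)%R).
  by apply: measurableT_comp => //; exact: measurable_funD.
transitivity (\int[pushforward mu (-%R : measurableTypeR R -> measurableTypeR R)]_x f (a + x)%R).
  by rewrite ge0_integral_pushforward.
by apply: eq_measure_integral => //= A mA _; exact: lebesgue_measureN.
Qed.

End translation.

(** * Exponential integrals against the normal law *)

Section gaussian.
Context {R : realType}.
Local Notation mu := (@lebesgue_measure R).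

(** The Radon-Nikodym derivative of the normal law and [normal_pdf] have the same integral over
    every measurable set, so they agree almost everywhere. *)
Lemma ge0_integral_normal_prob (m s : R) (f : R -> \bar R) :
  measurable_fun setT f -> (forall x, 0 <= f x)%E ->
  (\int[normal_prob m s]_x f x = \int[mu]_x (f x * (normal_pdf m s x)%:E))%E.
Proof.
move=> mf f0.
have dom := @normal_prob_dominates R m s.
rewrite -(Radon_Nikodym_SigmaFinite.change_of_variables dom)//.
apply: ae_eq_integral => //.
- apply: emeasurable_funM => //.
  by apply: (measurable_int mu); apply: Radon_Nikodym_SigmaFinite.f_integrable.
- by apply: emeasurable_funM => //; apply/measurable_EFinP; exact: measurable_normal_pdf.
- apply: ae_eqe_mul2l; apply: integral_ae_eq => //=.
  + exact: Radon_Nikodym_SigmaFinite.f_integrable.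
  + apply/measurable_EFinP; exact: measurable_normal_pdf.
  + by move=> E _ mE; rewrite -Radon_Nikodym_SigmaFinite.f_integral.
Qed.

(** Completing the square: the tilted density is a constant times the normal density with mean
    [m + l s^2] and the same [s]. *)
Lemma normal_prob_mgf (m s l : R) : s != 0 ->
  (\int[normal_prob m s]_x (expR (l * x))%:E =
   (expR (l * m + l ^+ 2 * s ^+ 2 / 2))%:E)%E.
Proof.
move=> s0; rewrite ge0_integral_normal_prob; last 2 first.
- apply/measurable_EFinP; apply: measurableT_comp => //; exact: mulrl_measurable.
- by move=> x; rewrite lee_fin expR_ge0.
transitivity (\int[mu]_x ((expR (l * m + l ^+ 2 * s ^+ 2 / 2))%:E *
    (normal_pdf (m + l * s ^+ 2) s x)%:E))%E.
  apply: eq_integral => x _; rewrite -!EFinM; congr EFin.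
  rewrite !normal_pdfE// /normal_fun !mulrA ![_ * normal_peak s]mulrC -!mulrA.
  congr (_ * _); rewrite -!expRD; congr expR.
  by field.
rewrite ge0_integralZl ?lee_fin ?expR_ge0// ?integral_normal_pdf ?mule1//.
- apply/measurable_EFinP; exact: measurable_normal_pdf.
- by move=> x _; rewrite lee_fin normal_pdf_ge0.
Qed.

(** The exponential factor changes the deviation [s] to [s / r]: the product with the density is
    [1 / r] times the centered normal density of deviation [s / r]. *)
Lemma normal_prob_expR_sqr (s r : R) : s != 0 -> 0 < r ->
  (\int[normal_prob 0 s]_x (expR (- ((r ^+ 2 - 1) / (s ^+ 2 *+ 2)) * x ^+ 2))%:E =
   (r^-1)%:E)%E.
Proof.
move=> s0 r0; have rn0 : r != 0 by rewrite gt_eqF.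
have sr0 : s / r != 0 by rewrite mulf_neq0// invr_eq0.
rewrite ge0_integral_normal_prob; last 2 first.
- apply/measurable_EFinP; apply: measurableT_comp => //.
  apply: measurable_funM => //; exact: exprn_measurable.
- by move=> x; rewrite lee_fin expR_ge0.
transitivity (\int[mu]_x ((r^-1)%:E * (normal_pdf 0 (s / r) x)%:E))%E.
  apply: eq_integral => x _; rewrite -!EFinM; congr EFin.
  rewrite !normal_pdfE// /normal_fun [LHS]mulrCA [RHS]mulrA; congr (_ * _); last first.
    rewrite -!expRD; congr expR; field; rewrite s0 rn0//.
  rewrite /normal_peak; apply/esym; rewrite -invfM; congr (_^-1).
  rewrite exprMn exprVn.
  rewrite -{1}(@ger0_norm _ r) ?(ltW r0)// -sqrtr_sqr -sqrtrM ?sqr_ge0//.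
  congr Num.sqrt; rewrite mulrnAr mulrA; congr (_ * _ *+ 2).
  by rewrite mulrCA divff ?mulr1// expf_eq0.
rewrite ge0_integralZl ?lee_fin ?invr_ge0 ?(ltW r0)// ?integral_normal_pdf ?mule1//.
- apply/measurable_EFinP; exact: measurable_normal_pdf.
- by move=> x _; rewrite lee_fin normal_pdf_ge0.
Qed.

End gaussian.

(** * Exponential moments of Gaussian variables *)

Section gaussian_rv.
Context {R : realType} {d} {T : measurableType d} (P : probability T R).
Variable X : T -> R.
Hypothesis mX : measurable_fun setT X.

(** The law is a parameter, so that the Dirac and the normal case of [is_gaussian_rv] are both
    covered. *)
Lemma ge0_integral_law (nu : {measure set (measurableTypeR R) -> \bar R})
    (f : measurableTypeR R -> \bar R) :
  (forall A, measurable A -> P (X @^-1` A) = nu A) ->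
  measurable_fun setT f -> (forall x, 0 <= f x)%E ->
  (\int[P]_w f (X w) = \int[nu]_x f x)%E.
Proof.
move=> XE mf f0.
transitivity (\int[pushforward P (X : T -> measurableTypeR R)]_x f x)%E.
  by rewrite ge0_integral_pushforward.
by apply: eq_measure_integral => //= A mA _; exact: XE.
Qed.

Lemma gaussian_mgf (m s : R) :
  (forall A : set R, measurable A ->
     P (X @^-1` A) = (if s == 0 then \d_m A else normal_prob m s A)) ->
  forall l : R, (\int[P]_w (expR (l * X w))%:E =
    (expR (l * m + l ^+ 2 * s ^+ 2 / 2))%:E)%E.
Proof.
move=> XE l.
have mf : measurable_fun setT (fun x : R => (expR (l * x))%:E).
  by apply/measurable_EFinP; apply: measurableT_comp.
have f0 x : (0 <= (expR (l * x))%:E)%E by rewrite lee_fin expR_ge0.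
have [s0|s0] := eqVneq s 0.
  rewrite (@ge0_integral_law (\d_(m : measurableTypeR R)) (fun x => (expR (l * x))%:E))//; last first.
    by move=> A mA; rewrite XE// s0 eqxx.
  rewrite integral_dirac// s0 expr0n/= mulr0 mul0r addr0.
  by rewrite diracE in_setT mul1e.
rewrite (@ge0_integral_law (normal_prob m s) (fun x => (expR (l * x))%:E))//.
  exact: normal_prob_mgf.
by move=> A mA; rewrite XE// (negbTE s0).
Qed.

(** Since [exp y >= 1 + y] and [E X = 0], one has [E exp (l X) >= 1] for all [l]. The exponent is
    thus a nonnegative quadratic in [l] that vanishes at [0], and its slope [m] there must be
    [0]. *)
Lemma centered_gaussian_mean (m s : R) :
  P.-integrable setT (fun w => (X w)%:E) -> (\int[P]_w (X w)%:E = 0)%E ->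
  (forall l : R, (\int[P]_w (expR (l * X w))%:E =
    (expR (l * m + l ^+ 2 * s ^+ 2 / 2))%:E)%E) -> m = 0.
Proof.
move=> iX EX mgf.
have key l : 0 <= l * m + l ^+ 2 * s ^+ 2 / 2.
  rewrite -ler_expR expR0 -lee_fin -mgf.
  have -> : (1 = \int[P]_w (1%:E + l%:E * (X w)%:E) :> \bar R)%E.
    rewrite integralD//; last 2 first.
    - exact: finite_measure_integrable_cst.
    - exact: integrableZl.
    by rewrite integralZl// EX mule0 adde0 integral_cst//;
    rewrite [X in (_ * X)%E](@probability_setT _ _ _ P) mule1.
  apply: le_integral => //.
  - apply: integrableD => //; first exact: finite_measure_integrable_cst.
    exact: integrableZl.
  - apply/integrableP; split.
      apply/measurable_EFinP; apply: measurableT_comp => //.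
      exact: measurable_funM.
    under eq_integral do rewrite gee0_abs ?lee_fin ?expR_ge0//.
    by rewrite mgf ltry.
  - by move=> w _; rewrite -EFinM -EFinD lee_fin expR_ge1Dx.
have q0 : 0 <= s ^+ 2 by exact: sqr_ge0.
set v := s ^+ 2 in key q0.
have v1 : 0 < v + 1 by lra.
(* at [l = - m / (v + 1)] the quadratic in [key] is negative unless [m = 0] *)
have := key (- m / (v + 1)).
have -> : - m / (v + 1) * m + (- m / (v + 1)) ^+ 2 * v / 2 =
    - (m ^+ 2 * ((v + 2) / (2 * (v + 1) ^+ 2))).
  by field; rewrite gt_eqF.
rewrite oppr_ge0 pmulr_lle0; last first.
  by rewrite divr_gt0 ?mulr_gt0 ?exprn_gt0//; lra.
by move=> m2; apply/eqP; rewrite -sqrf_eq0 eq_le m2 sqr_ge0.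
Qed.

(* Integrate [1 <= exp (- l X ^ 2) + l X ^ 2], whose first term has expectation [1 / r]
   for [l = (r ^ 2 - 1) / (2 s ^ 2)], and let [r] decrease to [1]. *)
Lemma gaussian_variance_le (s B : R) : s != 0 ->
  (forall A : set R, measurable A -> P (X @^-1` A) = normal_prob 0 s A) ->
  (\int[P]_w ((X w) ^+ 2)%:E <= B%:E)%E -> s ^+ 2 <= B.
Proof.
move=> s0 XE EX2.
have q0 : 0 < s ^+ 2 by rewrite exprn_even_gt0.
have key r : 1 < r -> 2 * s ^+ 2 <= B * (r * (r + 1)).
  move=> r1; have r0 : 0 < r by lra.
  pose l := (r ^+ 2 - 1) / (s ^+ 2 *+ 2).
  have l0 : 0 < l.
    by rewrite divr_gt0// ?mulrn_wgt0//; nra.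
  have mf : measurable_fun setT (fun x : R => (expR (- l * x ^+ 2))%:E).
    apply/measurable_EFinP; apply: measurableT_comp => //.
    by apply: measurable_funM.
  have f0 x : (0 <= (expR (- l * x ^+ 2))%:E)%E by rewrite lee_fin expR_ge0.
  have E1 : (\int[P]_w (expR (- l * X w ^+ 2))%:E = (r^-1)%:E)%E.
    rewrite (@ge0_integral_law (normal_prob 0 s)
      (fun x => (expR (- l * x ^+ 2))%:E))//.
    exact: normal_prob_expR_sqr.
  have : (1%:E <= (r^-1)%:E + l%:E * B%:E)%E.
    apply: (@le_trans _ _ (\int[P]_w ((expR (- l * X w ^+ 2))%:E + l%:E * (X w ^+ 2)%:E))%E).
      rewrite -[leLHS](@probability_setT _ _ _ P) -[leLHS]mul1e -integral_cst//.
      apply: ge0_le_lower_integral => //= w _.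
      rewrite -EFinM -EFinD lee_fin.
      have := expR_ge1Dx (- l * X w ^+ 2); lra.
    have mX2 : measurable_fun setT (fun w => (X w ^+ 2)%:E).
      by apply/measurable_EFinP; exact: measurable_funX.
    rewrite ge0_integralD//; last 3 first.
    - exact: (measurableT_comp mf mX).
    - by move=> w _; rewrite mule_ge0 ?lee_fin ?sqr_ge0// ltW.
    - exact: measurable_funeM.
    rewrite E1 leeD2l// ge0_integralZl//; last first.
    - by rewrite lee_fin ltW.
    - by move=> w _; rewrite lee_fin sqr_ge0.
    by rewrite lee_pmul2l.
  rewrite -EFinM -EFinD lee_fin /l => H1.
  have rn0 : r != 0 by rewrite gt_eqF.
  have H2 : 1 - r^-1 <= (r ^+ 2 - 1) / (s ^+ 2 *+ 2) * B by lra.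
  have E2 : 1 - r^-1 = (r - 1) / r by field.
  have E3 : (r ^+ 2 - 1) / (s ^+ 2 *+ 2) * B =
      (r - 1) * ((r + 1) * B / (2 * s ^+ 2)) by field.
  (* Both sides vanish at [r = 1]; cancelling [r - 1 > 0] leaves an inequality that is informative
     in the limit. *)
  move: H2; rewrite E2 E3 ler_pM2l; last by lra.
  have s2 : 0 < 2 * s ^+ 2 by lra.
  rewrite ler_pdivlMr// [_ * (2 * _)]mulrC ler_pdivrMr//.
  by rewrite (_ : (r + 1) * B * r = B * (r * (r + 1)))//; ring.
rewrite leNgt; apply/negP => Bs.
set a := s ^+ 2 in q0 key Bs.
have B0 : 0 <= B.
  rewrite -lee_fin; apply: le_trans EX2.
  by apply: integral_ge0 => w _; rewrite lee_fin sqr_ge0.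
(* With [e <= 1], [key (1 + e)] gives [2 a <= B (2 + 4 e)], and [4 B e <= 4 a e = a - B] turns this
   into [a <= B]. *)
pose e := (a - B) / (4 * a).
have e0 : 0 < e by rewrite divr_gt0//; lra.
have ea : e * (4 * a) = a - B by rewrite /e mulfVK// gt_eqF//; lra.
have e1 : e <= 1 by rewrite /e ler_pdivrMr; lra.
have := key (1 + e); nra.
Qed.

(** The mean parameter is [0], so the moment generating function at [1] is [exp (s^2 / 2)], and
    [s^2 <= B]. Only an upper bound on the second moment has to be supplied. *)
Lemma centered_gaussian_expR_le (B : R) : is_gaussian_rv P X ->
  P.-integrable setT (fun w => (X w)%:E) -> (\int[P]_w (X w)%:E = 0)%E ->
  (\int[P]_w ((X w) ^+ 2)%:E <= B%:E)%E ->
  (\int[P]_w (expR (X w))%:E <= (expR (B / 2))%:E)%E.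
Proof.
move=> [m [s XE]] iX EX EX2.
have mgf := gaussian_mgf m s XE.
have m0 := centered_gaussian_mean m s iX EX mgf.
have := mgf 1; under eq_integral do rewrite mul1r.
move=> ->; rewrite m0 mulr0 add0r expr1n mul1r lee_fin ler_expR ler_pM2r//.
have [s0|s0] := eqVneq s 0.
  rewrite s0 expr0n/= -lee_fin; apply: le_trans EX2.
  by apply: integral_ge0 => w _; rewrite lee_fin sqr_ge0.
apply: (gaussian_variance_le s B s0) => // A mA.
by rewrite XE// (negbTE s0) m0.
Qed.

End gaussian_rv.

(** * Joint measurability of a continuous process in time and chance *)

Section joint_measurability.
Context {R : realType} {d} {T : measurableType d}.
Variable W : R -> T -> R.
Hypothesis mW : forall t, measurable_fun setT (W t).

(** The process frozen at the left end of each cell of the grid of mesh [1 / (n + 1)]. It takes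
    countably many time values, and continuity of the paths makes it converge pointwise to [W]. *)
Definition grid_process (n : nat) (t : R) (w : T) : R :=
  W ((Num.floor (n.+1%:R * t))%:~R / n.+1%:R) w.

Lemma measurable_grid_process n :
  measurable_fun setT (fun z : measurableTypeR R * T => grid_process n z.1 z.2).
Proof.
move=> _ A mA; rewrite setTI.
pose D (k : int) : set (measurableTypeR R) := `[(k%:~R / n.+1%:R)%R, ((k + 1)%:~R / n.+1%:R)%R[%classic.
(* On the strip over a cell [D k] the process depends on chance only, so the preimage is a countable
   union of rectangles. *)
rewrite (_ : _ @^-1` A = \bigcup_k (D k `*` (W (k%:~R / n.+1%:R) @^-1` A))); last first.
  have n0 : (0 : R) < n.+1%:R by [].
  have DE k t : D k t <-> Num.floor (n.+1%:R * t) = k.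
    rewrite /D /= in_itv/= ler_pdivrMr// ltr_pdivlMr// ![t * _]mulrC -floor_eq.
    by split => /eqP.
  apply/seteqP; split => -[t w] /=.
    by move=> Aw; exists (Num.floor (n.+1%:R * t)) => //; split => //=; exact/DE.
  by move=> [k _ [/= /DE tk Aw]]; rewrite /grid_process tk.
apply: countable_bigcupT_measurable => // k.
apply: measurableX; first exact: measurable_itv.
by rewrite -[X in measurable X]setTI; exact: mW.
Qed.

Lemma cvg_grid_process w t : continuous (W^~ w) ->
  (grid_process n t w @[n --> \oo] --> W t w).
Proof.
move=> cW; suff H : (Num.floor (n.+1%:R * t))%:~R / n.+1%:R @[n --> \oo] --> t.
  exact: (cvg_comp _ (W^~ w) H (cW t)).
apply/cvgrPdist_le => e e0.
near=> n; have n0 : (0 : R) < n.+1%:R by [].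
have /andP[h1 h2] := floor_itv (n.+1%:R * t).
have h3 : n.+1%:R^-1 <= e.
  near: n; have := @cvg_harmonic R => /cvgrPdist_le /(_ e e0).
  by apply: filterS => n; rewrite sub0r normrN ger0_norm// invr_ge0.
apply: le_trans h3.
rewrite intrD in h2.
have -> : t - (Num.floor (n.+1%:R * t))%:~R / n.+1%:R =
    (n.+1%:R * t - (Num.floor (n.+1%:R * t))%:~R) / n.+1%:R.
  by field; rewrite addrC natr1.
rewrite ger0_norm ?divr_ge0 ?subr_ge0// -[leRHS]mul1r ler_pM2r ?invr_gt0//.
by rewrite lerBlDl; apply: ltW.
Unshelve. all: by end_near. Qed.

Lemma measurable_continuous_process : (forall w, continuous (W^~ w)) ->
  measurable_fun setT (fun z : measurableTypeR R * T => W z.1 z.2).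
Proof.
move=> cW; apply: (@measurable_fun_cvg _ _ _ setT
  (fun n (z : measurableTypeR R * T) => grid_process n z.1 z.2)).
  by move=> n; exact: measurable_grid_process.
by move=> [t w] _; exact: cvg_grid_process.
Qed.

End joint_measurability.

(** * Integrability of the stretched exponential tail *)

Section tail_integrability.
Context {R : realType}.
Local Notation mu := (@lebesgue_measure R).

Lemma integral_oneDsqrV_lty : (\int[mu]_x ((1 + x ^+ 2)^-1)%:E < +oo)%E.
Proof.
rewrite ge0_symfun_integralT.
- rewrite -set_itvcy (_ : integral _ _ _ = (pi / 2)%:E); first by rewrite -EFinM ltry.
  exact: integral0y_oneDsqr.
- by move=> x; rewrite invr_ge0 addr_ge0// sqr_ge0.
- exact: continuous_oneDsqrV.
- by move=> x /=; rewrite sqrrN.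
Qed.

Lemma powR_expR_bound (p : R) : 0 < p -> exists2 C : R, 0 <= C &
  forall x, 0 <= x -> x * expR (- (x `^ p / 32)) <= C / (1 + x ^+ 2).
Proof.
move=> p0; pose u := 6 / p; pose k := 32 * u ^+ 2.
(* with [y = ln x], [x^p / 32 = (e^(p y / 2))^2 / 32 >= p^2 y^2 / 128 >= 3 y - k / 4], where [p u = 6] *)
exists (2 * expR k) => [|x x0]; first by rewrite mulr_ge0// expR_ge0.
have pu : p * u = 6 by rewrite /u mulrC mulfVK// gt_eqF.
have k0 : 0 < k by rewrite /k mulr_gt0// exprn_gt0// divr_gt0.
have D0 : 0 < 1 + x ^+ 2 by have := sqr_ge0 x; lra.
rewrite ler_pdivlMr//.
(* For [x <= 1] the crude bounds [x (1 + x^2) <= 2] and [exp (- x^p / 32) <= 1] suffice; the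
   logarithmic argument uses [ln x > 0]. *)
have [x1|x1] := leP x 1.
  have : expR (- (x `^ p / 32)) <= 1.
    by rewrite -expR0 ler_expR oppr_le0 divr_ge0// powR_ge0.
  have := expR_gt0 (- (x `^ p / 32)).
  have : 1 <= expR k by rewrite -expR0 ler_expR ltW.
  set e := expR _; set e' := expR _ => ke1 e0 e1.
  have : x * (1 + x ^+ 2) <= 2 by nra.
  have := mulr_ge0 x0 (ltW D0); nra.
have xx : x = expR (ln x) by rewrite lnK// posrE; lra.
have y0 : 0 < ln x by rewrite ln_gt0.
set y := ln x in xx y0.
have pw : x `^ p = expR (p * y / 2) ^+ 2.
  rewrite /powR gt_eqF; last by lra.
  by rewrite -expRM_natl; congr expR; rewrite -/y; field.
have hw : (p * y / 2) ^+ 2 <= x `^ p.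
  rewrite pw; have := expR_ge1Dx (p * y / 2).
  have : 0 < p * y / 2 by rewrite divr_gt0// mulr_gt0.
  nra.
have hx : x * (1 + x ^+ 2) <= 2 * x ^+ 3 by nra.
have -> : x * expR (- (x `^ p / 32)) * (1 + x ^+ 2) =
  x * (1 + x ^+ 2) * expR (- (x `^ p / 32)) by ring.
apply: (le_trans (ler_wpM2r (expR_ge0 _) hx)).
rewrite -mulrA ler_pM2l// {1}xx -expRM_natl -expRD ler_expR.
suff : 3 * y <= (p * y / 2) ^+ 2 / 32 + k by lra.
have := sqr_ge0 (p * y - 32 * u).
have -> : (p * y - 32 * u) ^+ 2 = (p * y) ^+ 2 - 64 * (p * u) * y + 32 * k.
  by rewrite /k; ring.
have -> : (p * y / 2) ^+ 2 = (p * y) ^+ 2 / 4 by field.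
rewrite pu; lra.
Qed.

Lemma integral_expR_powR_lty (p : R) : 0 < p ->
  (\int[mu]_t (`|t| * expR (- (`|t| `^ p / 32)))%:E < +oo)%E.
Proof.
move=> p0; have [C C0 HC] := powR_expR_bound p p0.
apply: (@le_lt_trans _ _ (\int[mu]_t (C%:E * ((1 + t ^+ 2)^-1)%:E))%E).
  apply: ge0_le_lower_integral => t _.
    by rewrite lee_fin mulr_ge0// expR_ge0.
  by rewrite -EFinM lee_fin (le_trans (HC _ _))// -normrX ger0_norm// sqr_ge0.
rewrite ge0_integralZl//.
- by rewrite lte_mul_pinfty// integral_oneDsqrV_lty.
- apply/measurable_EFinP; apply: continuous_measurable_fun.
  exact: continuous_oneDsqrV.
- by move=> x _; rewrite lee_fin invr_ge0 addr_ge0// sqr_ge0.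
Qed.

End tail_integrability.

(** * Bounding the inverse of the total mass *)

Section inverse_mass.
Context {R : realType}.
Local Notation mu := (@lebesgue_measure R).

Lemma inv_mass_le (g h : R -> R) (c : R) : 0 < c ->
  measurable_fun setT g -> measurable_fun setT h ->
  (\int[mu]_(s in `[0%R, 1%R]) (expR (g s))%:E <= c%:E)%E ->
  (\int[mu]_(s in `[0%R, 1%R]) (expR (h s))%:E <= c%:E)%E ->
  ((c^-1)%:E <= \int[mu]_(s in `[0%R, 1%R]) (expR (- ((g s + h s) / 2)))%:E)%E.
Proof.
move=> c0 mg mh ig ih.
(* The weight for which the two exponential integrals contribute at most [2 k c = 1 / c], which
   leaves [2 / c - 1 / c]. *)
pose k := (2 * c ^+ 2)^-1.
have k0 : 0 < k by rewrite invr_gt0 mulr_gt0// exprn_gt0.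
have mu01 : mu `[0%R, 1%R]%classic = 1%E.
  by rewrite lebesgue_measure_itv/= lte_fin ltr01 -EFinD subr0.
have meg : measurable_fun (`[0%R, 1%R]%classic : set R) (fun s => (expR (g s))%:E).
  by apply/measurable_funTS/measurable_EFinP; exact: measurableT_comp.
have meh : measurable_fun (`[0%R, 1%R]%classic : set R) (fun s => (expR (h s))%:E).
  by apply/measurable_funTS/measurable_EFinP; exact: measurableT_comp.
have mem : measurable_fun (`[0%R, 1%R]%classic : set R) (fun s => (expR (- ((g s + h s) / 2)))%:E).
  apply/measurable_funTS/measurable_EFinP; apply: measurableT_comp => //.
  apply: measurableT_comp => //; apply: measurable_funM => //.
  exact: measurable_funD.
(* [1 / y >= 2 / c - y / c ^ 2] at [y = e ^ ((g + h) / 2)], which is at most the mean of [e ^ g] and [e ^ h] *)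
have pt s : 2 / c <= expR (- ((g s + h s) / 2)) + (k * expR (g s) + k * expR (h s)).
  have gE : expR (g s) = expR (g s / 2) ^+ 2.
    by rewrite -expRM_natl; congr expR; field.
  have hE : expR (h s) = expR (h s / 2) ^+ 2.
    by rewrite -expRM_natl; congr expR; field.
  have -> : expR (- ((g s + h s) / 2)) = (expR (g s / 2) * expR (h s / 2))^-1.
    by rewrite expRN -expRD -mulrDl.
  rewrite gE hE; have := expR_gt0 (g s / 2); have := expR_gt0 (h s / 2).
  set a := expR (g s / 2); set b := expR (h s / 2) => b0 a0.
  have ab0 : 0 < a * b by rewrite mulr_gt0.
  have h1 : 2 / c <= (a * b)^-1 + (a * b) / c ^+ 2.
    rewrite -subr_ge0.
    have -> : (a * b)^-1 + a * b / c ^+ 2 - 2 / c = (a * b) * ((a * b)^-1 - c^-1) ^+ 2.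
      by field; rewrite !gt_eqF.
    by rewrite mulr_ge0 ?sqr_ge0// ltW.
  have h2 : (a * b) / c ^+ 2 <= k * a ^+ 2 + k * b ^+ 2.
    rewrite -subr_ge0.
    have -> : k * a ^+ 2 + k * b ^+ 2 - a * b / c ^+ 2 = k * (a - b) ^+ 2.
      by rewrite /k; field; rewrite gt_eqF.
    by rewrite mulr_ge0 ?sqr_ge0// ltW.
  lra.
have : ((2 / c)%:E <= \int[mu]_(s in `[0%R, 1%R]) (expR (- ((g s + h s) / 2)))%:E +
    (k%:E * c%:E + k%:E * c%:E))%E.
  apply: (@le_trans _ _ (\int[mu]_(s in `[0%R, 1%R])
     ((expR (- ((g s + h s) / 2)))%:E + (k%:E * (expR (g s))%:E + k%:E * (expR (h s))%:E)))%E).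
    rewrite -[leLHS]mule1 -mu01 -integral_cst//.
    apply: ge0_le_lower_integral => s _ /=; first by rewrite lee_fin divr_ge0// ltW.
    by rewrite -!EFinM -!EFinD lee_fin.
  have k0' : (0 <= k%:E)%E by rewrite lee_fin ltW.
  have e0k (f : R -> R) : forall s, `[0%R, 1%R]%classic s -> (0 <= k%:E * (expR (f s))%:E)%E.
    by move=> s _; rewrite mule_ge0// lee_fin expR_ge0.
  have mkg := measurable_funeM k%:E meg.
  have mkh := measurable_funeM k%:E meh.
  rewrite ge0_integralD//; last 2 first.
  - by move=> s s01; rewrite adde_ge0//; [exact: e0k|exact: e0k].
  - exact: emeasurable_funD.
  rewrite ge0_integralD//; last 2 first.
  - exact: e0k.
  - exact: e0k.
  rewrite !ge0_integralZl//.
  by rewrite leeD2l// leeD// lee_wpmul2l.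
have kc : k * c + k * c = c^-1 by rewrite /k; field; rewrite gt_eqF.
rewrite -!EFinM -EFinD kc.
case: (integral _ _ _) => [x| |] //=.
  by rewrite -EFinD !lee_fin; lra.
by move=> _; rewrite leey.
Qed.

End inverse_mass.

(** * The kernel dominating the density, and its expectation *)

Section pitman.
Context {R : realType} {d} {T : measurableType d} (P : probability T R).
Variables (H : R) (W : R -> T -> R).
Local Notation mu := (@lebesgue_measure R).
Local Notation p := (2 * H).

(** A sign with value [1] at [0], so that multiplication by it is always an isometry. *)
Definition signr (t : R) : R := if 0 <= t then 1 else -1.

(* [Z_t / sqrt (Z_u Z_v)], with [u] in the unit interval next to [0] and [v] in
   the one next to [t], both on the segment from [0] to [t] when [1 <= |t|] *)
Definition pitman_kernel (t s : R) (w : T) : R :=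
  let u := signr t * s in let v := t - signr t * s in
  expR ((W t w - `|t| `^ p / 2) -
    ((W u w - `|u| `^ p / 2) + (W v w - `|v| `^ p / 2)) / 2).

Lemma normr_signr t s : `|signr t * s| = `|s|.
Proof. by rewrite /signr; case: ifP; rewrite ?mul1r ?mulN1r ?normrN. Qed.

(** Moving from [t] towards [0] by at most [1] can overshoot [0] when [|t| < 1]; hence the maximum
    with [1]. *)
Lemma normr_sub_signr t s : 0 <= s <= 1 -> `|t - signr t * s| <= Num.max `|t| 1.
Proof.
move=> /andP[s0 s1]; rewrite /signr le_max !ler_norml.
case: (leP 0 t) => t0; rewrite ?(ger0_norm t0) ?(ltr0_norm t0).
  by have [?|?] := leP 1 t; apply/orP; [left|right]; apply/andP; split; lra.
by have [?|?] := leP 1 (- t); apply/orP; [left|right]; apply/andP; split; lra.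
Qed.

Lemma powR_max1_le (x : R) : 0 <= x -> Num.max x 1 `^ p <= x `^ p + 1.
Proof.
move=> x0; rewrite /Num.max; case: ifP => _.
  by rewrite powR1 lerDr powR_ge0.
by rewrite lerDl.
Qed.

Hypothesis H0 : 0 < H.
Hypothesis H1 : H <= 1.

Let p0 : 0 <= p. Proof. by rewrite mulr_ge0// ltW. Qed.

Lemma powR_unit_le1 (x : R) : 0 <= x <= 1 -> x `^ p <= 1.
Proof. 
move=> /andP[x0 x1]; have E : 1 `^ p = 1 :> R by rewrite powR1.
by rewrite -[leRHS]E ge0_ler_powR// nnegrE.
 Qed.

Lemma powR_2H_le4 : 2 `^ p <= 4 :> R.
Proof.
have -> : 4 = 2 `^ 2 :> R by rewrite powR_mulrn//; ring.
by rewrite ler_powR ?ler1n// -[leRHS]mulr1 ler_pM2l.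
Qed.

Hypothesis fbm : is_two_sided_fBm P H W.

Let mW : forall s, measurable_fun setT (W s).
Proof. by case: fbm. Qed.

(** The exponent is half the sum of the increments from [u] and from [v] to [t], so variances of
    increments bound its second moment. The cross term costs a factor 3/2 on the first and 3 on the
    second, which is the short one in the application. *)
Lemma fBm_combination_expR_le (t u v B : R) :
  3 / 8 * `|t - u| `^ p + 3 / 4 * `|t - v| `^ p <= B ->
  (\int[P]_w (expR (W t w - (W u w + W v w) / 2))%:E <= (expR (B / 2))%:E)%E.
Proof.
move=> hB.
have [_ [gauss [_ [_ [cent var]]]]] := fbm.
pose X w := W t w - (W u w + W v w) / 2.
have iW s : P.-integrable setT (fun w => (W s w)%:E) by case: (cent s).
have EW s : (\int[P]_w (W s w)%:E = 0)%E by case: (cent s).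
have mX : measurable_fun setT X.
  apply: measurable_funB => //; apply: measurable_funM => //.
  exact: measurable_funD.
have XE : (fun w => (X w)%:E) =
    (fun w => (W t w)%:E - (2^-1)%:E * ((W u w)%:E + (W v w)%:E))%E.
  by apply/funext => w /=; congr EFin; rewrite /X [_ / 2]mulrC.
have iuv : P.-integrable setT (fun w => (W u w)%:E + (W v w)%:E)%E.
  exact: integrableD.
have i2uv : P.-integrable setT (fun w => (2^-1)%:E * ((W u w)%:E + (W v w)%:E))%E.
  exact: integrableZl.
apply: (@centered_gaussian_expR_le _ _ _ P X mX B).
- have := gauss 3 (fun i => nth 0 [:: t; u; v] i) (fun i => nth 0 [:: 1; - 2^-1; - 2^-1] i).
  congr is_gaussian_rv; apply/funext => w.
  rewrite !big_ord_recl big_ord0 /= /X; lra.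
- by rewrite XE; exact: integrableB.
- rewrite XE integralB// EW sub0e integralZl// integralD// !EW.
  by rewrite adde0 mule0 oppe0.
- apply: (@le_trans _ _ (\int[P]_w ((3 / 8)%:E * ((W t w - W u w) ^+ 2)%:E +
      (3 / 4)%:E * ((W t w - W v w) ^+ 2)%:E))%E).
    apply: ge0_le_lower_integral => w _; first by rewrite lee_fin sqr_ge0.
    rewrite -!EFinM -EFinD lee_fin /X.
    (* For increments [A] and [D], [3/8 A^2 + 3/4 D^2 - ((A + D) / 2)^2 = (A - 2 D)^2 / 8]. *)
    have := sqr_ge0 (W t w - W u w - 2 * (W t w - W v w)).
    set a := W t w; set b := W u w; set c := W v w; nra.
  have mq a b : measurable_fun setT (fun w => ((W a w - W b w) ^+ 2)%:E).
    by apply/measurable_EFinP; apply: measurable_funX; exact: measurable_funB.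
  have q0 a b w : (0 <= ((W a w - W b w) ^+ 2)%:E)%E by rewrite lee_fin sqr_ge0.
  have c1 : (0 <= (3 / 8 : R)%:E)%E by rewrite lee_fin; lra.
  have c2 : (0 <= (3 / 4 : R)%:E)%E by rewrite lee_fin; lra.
  rewrite ge0_integralD//; last 4 first.
  - by move=> w _; rewrite mule_ge0.
  - exact: measurable_funeM.
  - by move=> w _; rewrite mule_ge0.
  - exact: measurable_funeM.
  by rewrite !ge0_integralZl// !var -!EFinM -EFinD lee_fin.
Qed.

Lemma pitman_kernel_expectation (t s : R) : 0 <= s <= 1 ->
  (\int[P]_w (pitman_kernel t s w)%:E <= (expR (2 - `|t| `^ p / 16))%:E)%E.
Proof.
move=> s01; rewrite /pitman_kernel /=.
set u := signr t * s; set v := t - u.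
have u1 : `|u| `^ p <= 1.
  by rewrite normr_signr ger0_norm ?powR_unit_le1//; case/andP: s01.
have v1 : `|v| `^ p <= `|t| `^ p + 1.
  apply: le_trans (powR_max1_le _ (normr_ge0 t)).
  apply: ge0_ler_powR; rewrite ?nnegrE ?normr_ge0 ?le_max ?ler01 ?orbT//.
  by rewrite -le_max; exact: normr_sub_signr.
have tu : t - u = v by [].
have tv : t - v = u by rewrite /v opprB addrC subrK.
(* The increment from [u] has length [|v|] and the one from [v] has length [|u| <= 1], so only the
   first grows with [t]. *)
pose B := 3 / 8 * (`|t| `^ p + 1) + 3 / 4.
have hB : 3 / 8 * `|t - u| `^ p + 3 / 4 * `|t - v| `^ p <= B.
  rewrite tv tu /B; move: (`|t| `^ p) (`|u| `^ p) (`|v| `^ p) u1 v1 => x y z.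
  by lra.
pose c := - (`|t| `^ p / 2) + (`|u| `^ p + `|v| `^ p) / 4.
(* The coefficient of [|t|^p] is at most [- 1/2 + 1/4 + 3/16 = - 1/16]; the constants add up to
   17/16. *)
have cB : c + B / 2 <= 2 - `|t| `^ p / 16.
  rewrite /c /B; move: (`|t| `^ p) (`|u| `^ p) (`|v| `^ p) u1 v1 => x y z.
  by lra.
have -> : (\int[P]_w (expR ((W t w - `|t| `^ p / 2) -
    ((W u w - `|u| `^ p / 2) + (W v w - `|v| `^ p / 2)) / 2))%:E =
    \int[P]_w ((expR c)%:E * (expR (W t w - (W u w + W v w) / 2))%:E))%E.
  apply: eq_integral => w _; rewrite -EFinM -expRD; congr ((expR _)%:E).
  rewrite /c; move: (`|t| `^ p) (`|u| `^ p) (`|v| `^ p) (W t w) (W u w) (W v w).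
  by move=> x1 x2 x3 x4 x5 x6; field.
rewrite ge0_integralZl//; last first.
  apply/measurable_EFinP; apply: measurableT_comp => //.
  apply: measurable_funB => //; apply: measurable_funM => //.
  exact: measurable_funD.
apply: (@le_trans _ _ ((expR c)%:E * (expR (B / 2))%:E)%E).
  rewrite lee_wpmul2l ?lee_fin ?expR_ge0//; exact: fBm_combination_expR_le.
by rewrite -EFinM -expRD lee_fin ler_expR.
Qed.

End pitman.

(** * Mass along the unit segments starting at the two endpoints *)

Section signr_integral.
Context {R : realType}.
Local Notation mu := (@lebesgue_measure R).

(** Both parametrizations are translations or reflections of the line, hence preserve Lebesgue
    measure, and restricting to the unit interval can only decrease the integral. *)
Lemma integral_signr_le (f : R -> \bar R) (t : R) :
  measurable_fun setT f -> (forall x, 0 <= f x)%E ->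
  (\int[mu]_(s in `[0%R, 1%R]) f (signr t * s)%R <= \int[mu]_s f s)%E /\
  (\int[mu]_(s in `[0%R, 1%R]) f (t - signr t * s)%R <= \int[mu]_s f s)%E.
Proof.
move=> mf f0.
have sub (g : R -> \bar R) : measurable_fun setT g -> (forall x, 0 <= g x)%E ->
    (\int[mu]_(s in `[0%R, 1%R]) g s <= \int[mu]_s g s)%E.
  by move=> mg g0; exact: ge0_subset_integral.
have mfB (a : R) : measurable_fun setT (fun x : R => f (a - x)).
  by apply: measurableT_comp => //; exact: measurable_funB.
have mfD (a : R) : measurable_fun setT (fun x : R => f (a + x)).
  by apply: measurableT_comp => //; exact: measurable_funD.
rewrite /signr; case: ifP => _; split.
- by under eq_integral do rewrite mul1r; exact: sub.
- under eq_integral do rewrite mul1r.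
  by rewrite -[leRHS](@ge0_integral_reflection _ t f)//; exact: (sub (fun x => f (t - x))).
- under eq_integral do rewrite mulN1r -sub0r.
  by rewrite -[leRHS](@ge0_integral_reflection _ 0 f)//; exact: (sub (fun x => f (0 - x))).
- under eq_integral do rewrite mulN1r opprK.
  by rewrite -[leRHS](@ge0_integral_translation _ t f)//; exact: (sub (fun x => f (t + x))).
Qed.

End signr_integral.

(** * Pathwise bound on the exponential of [pitman_zeta] *)

Section pitman_bound.
Context {R : realType} {d} {T : measurableType d}.
Variables (H : R) (W : R -> T -> R).
Local Notation mu := (@lebesgue_measure R).
Local Notation p := (2 * H).
Hypothesis H0 : 0 < H.
Hypothesis H1 : H <= 1.
Hypothesis cW : forall w, continuous (fun s => W s w).

Let mpowR : measurable_fun setT (fun t : R => `|t| `^ p).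
Proof.
exact: (measurableT_comp (measurable_powR p) (@normr_measurable R setT)).
Qed.

Let p0 : 0 <= p. Proof. by rewrite mulr_ge0// ltW. Qed.

Let lnZ w t := W t w - `|t| `^ p / 2.

Let mlnZ w : measurable_fun setT (lnZ w).
Proof.
apply: measurable_funB; first by apply: continuous_measurable_fun; exact: cW.
exact: measurable_funM.
Qed.

Let mZ w : measurable_fun setT (fun t => fbm_Z H W t w).
Proof. by apply: (@measurableT_comp _ _ _ _ _ _ expR setT (lnZ w)). Qed.

Let mexplnZ w : measurable_fun setT (fun t => (expR (lnZ w t))%:E).
Proof. by apply/measurable_EFinP; exact: measurableT_comp. Qed.

(** The bound on [1 / c], applied to [ln Z] along the two unit segments and multiplied by [Z_t]. *)
Lemma density_le_kernel (w : T) (c t : R) : 0 < c ->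
  (\int[mu]_u (fbm_Z H W u w)%:E = c%:E)%E ->
  ((fbm_Z H W t w / c)%:E <=
    \int[mu]_(s in `[0%R, 1%R]) (pitman_kernel H W t s w)%:E)%E.
Proof.
move=> c0 cE.
have [i1 i2] := integral_signr_le (fun s => (expR (lnZ w s))%:E) t (mexplnZ w)
  (fun s => expR_ge0 (lnZ w s)).
rewrite [X in (_ <= X)%E]cE in i1; rewrite [X in (_ <= X)%E]cE in i2.
have m1 : measurable_fun setT (fun s => lnZ w (signr t * s)).
  by apply: measurableT_comp => //; exact: mulrl_measurable.
have m2 : measurable_fun setT (fun s => lnZ w (t - signr t * s)).
  by apply: measurableT_comp => //; apply: measurable_funB.
have := inv_mass_le _ _ c c0 m1 m2 i1 i2.
have -> : (\int[mu]_(s in `[0%R, 1%R]) (pitman_kernel H W t s w)%:E =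
    \int[mu]_(s in `[0%R, 1%R]) ((fbm_Z H W t w)%:E *
      (expR (- ((lnZ w (signr t * s) + lnZ w (t - signr t * s)) / 2)))%:E))%E.
  by apply: eq_integral => s _; rewrite -EFinM /fbm_Z -expRD.
have mh : measurable_fun setT (fun s =>
    (expR (- ((lnZ w (signr t * s) + lnZ w (t - signr t * s)) / 2)))%:E).
  apply/measurable_EFinP; apply: measurableT_comp => //.
  apply: measurableT_comp => //; apply: measurable_funM => //.
  exact: measurable_funD.
have Z0 : (0 <= (fbm_Z H W t w)%:E)%E by rewrite lee_fin expR_ge0.
rewrite ge0_integralZl//; last exact: measurable_funTS.
by move=> h; rewrite EFinM lee_wpmul2l.
Qed.

(** Let [z = |zeta|]. If [z < 2], then [z^p <= 4] and the first term suffices. Otherwise [z] is at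
    most the mean of [|t|] under [q], to which the region [|t| <= z / 2] contributes at most
    [z / 2]; the remaining half, at least [1], gives the integral term. *)
Lemma expR_pitman_zeta_le (a : R) (w : T) : 0 <= a ->
  ((expR (a * `|pitman_zeta H W w| `^ p))%:E <= (expR (4 * a))%:E +
    \int[mu]_t ((`|t| * expR (4 * a * `|t| `^ p))%:E *
      \int[mu]_(s in `[0%R, 1%R]) (pitman_kernel H W t s w)%:E))%E.
Proof.
move=> a0; set G := (X in (_ + X)%E).
have K0 t : (0 <= \int[mu]_(s in `[0%R, 1%R]) (pitman_kernel H W t s w)%:E)%E.
  by apply: integral_ge0 => s _; rewrite lee_fin expR_ge0.
have G0 : (0 <= G)%E.
  apply: integral_ge0 => t _; rewrite mule_ge0// lee_fin mulr_ge0// expR_ge0.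
set z := `|pitman_zeta H W w|.
have z0 : 0 <= z by exact: normr_ge0.
have [z2|z2] := ltP z 2.
  apply: (@le_trans _ _ (expR (4 * a))%:E); last by rewrite leeDl.
  rewrite lee_fin ler_expR mulrC ler_wpM2r//.
  apply: le_trans (powR_2H_le4 H H1).
  by apply: ge0_ler_powR; rewrite ?nnegrE// ltW.
apply: (@le_trans _ _ G); last by rewrite leeDr// lee_fin expR_ge0.
pose c := Rintegral mu [set: R] (fun u => fbm_Z H W u w).
have qE t : fbm_q H W t w = fbm_Z H W t w / c by [].
(* [fine] sends both infinities to [0], so a nonzero real-valued integral comes from a finite
   one. *)
have fin_neq0 (x : \bar R) : fine x != 0 -> x = (fine x)%:E.
  by case: x => //=; rewrite eqxx.
(* Division by zero yields [0]: if [c] vanished, so would [q] and [zeta], against [z >= 2]. Hence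
   the total mass is finite. *)
have cn0 : c != 0.
  apply/eqP => c0; move: z2; rewrite /z /pitman_zeta.
  under eq_Rintegral do rewrite qE c0 invr0 mulr0 mulr0.
  by rewrite /Rintegral integral0 /= normr0 lern0.
have cE : (\int[mu]_u (fbm_Z H W u w)%:E = c%:E)%E by exact: fin_neq0.
have c0 : 0 < c.
  rewrite lt_neqAle eq_sym cn0 /= -lee_fin -cE.
  by apply: integral_ge0 => u _; rewrite lee_fin expR_ge0.
have zE : (\int[mu]_t (t * fbm_q H W t w)%:E = (pitman_zeta H W w)%:E)%E.
  by apply: fin_neq0; rewrite -normr_eq0 gt_eqF// (lt_le_trans _ z2).
have mq : measurable_fun setT (fun t => fbm_q H W t w).
  under eq_fun do rewrite qE.
  exact: measurable_funM.
have mqE : measurable_fun setT (fun t => (fbm_q H W t w)%:E).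
  by apply/measurable_EFinP; exact: mq.
have q0 t : 0 <= fbm_q H W t w by rewrite qE divr_ge0 ?expR_ge0// ltW.
have q1 : (\int[mu]_t (fbm_q H W t w)%:E = 1)%E.
  under eq_integral do rewrite qE mulrC EFinM.
  rewrite ge0_integralZl//; last 3 first.
  - exact: mexplnZ.
  - by move=> t _; rewrite lee_fin expR_ge0.
  - by rewrite lee_fin invr_ge0 ltW.
  by rewrite cE -EFinM mulVf.
pose E := expR (a * z `^ p).
have E0 : 0 < E by exact: expR_gt0.
have zle : (z%:E <= \int[mu]_t (`|t| * fbm_q H W t w)%:E)%E.
  have -> : z%:E = (`| (pitman_zeta H W w)%:E |)%E by [].
  rewrite -zE.
  apply: (le_trans (le_abse_integral _ _ _)) => //.
    by apply/measurable_EFinP; exact: measurable_funM.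
  apply: ge0_le_lower_integral => // t _.
  by rewrite /= normrM (ger0_norm (q0 t)).
have mtq : measurable_fun setT (fun t : R => (`|t| * fbm_q H W t w)%:E).
  by apply/measurable_EFinP; apply: measurable_funM.
pose F (t : R) := `|t| * expR (4 * a * `|t| `^ p) * fbm_q H W t w.
have F0 t : 0 <= F t by rewrite /F; do 2?apply: mulr_ge0 => //.
have mF : measurable_fun setT F.
  apply: measurable_funM => //; apply: measurable_funM => //.
  apply: measurableT_comp => //; exact: measurable_funM.
have FG : (\int[mu]_t (F t)%:E <= G)%E.
  apply: ge0_le_lower_integral => t _; first by rewrite lee_fin.
  rewrite /F EFinM lee_wpmul2l ?lee_fin ?mulr_ge0 ?expR_ge0//.
  by rewrite qE; exact: density_le_kernel.
have Ez0 : 0 <= E * z / 2 by rewrite divr_ge0// mulr_ge0// ltW.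
(* only [|t| > z / 2] matters, and there [z ^ p <= 4 |t| ^ p] *)
have pt t : E * (`|t| * fbm_q H W t w) <= E * z / 2 * fbm_q H W t w + F t.
  rewrite /F mulrA -mulrDl ler_wpM2r//.
  have [tz|tz] := leP `|t| (z / 2).
    rewrite -[leLHS]addr0; apply: lerD; last by rewrite mulr_ge0.
    by rewrite -mulrA ler_wpM2l// ltW.
  rewrite -[leLHS]add0r; apply: lerD => //.
  rewrite mulrC ler_wpM2l// /E ler_expR -mulrA mulrCA ler_wpM2l//.
  apply: (@le_trans _ _ ((2 * `|t|) `^ p)).
    apply: ge0_ler_powR => //; rewrite ?nnegrE ?mulr_ge0//.
    by rewrite mulrC -ler_pdivrMr// ltW.
  by rewrite powRM// ler_wpM2r ?powR_ge0 ?powR_2H_le4.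
have key : ((E * z)%:E <= (E * z / 2)%:E + \int[mu]_t (F t)%:E)%E.
  apply: (@le_trans _ _ (\int[mu]_t (E%:E * (`|t| * fbm_q H W t w)%:E))%E).
    rewrite ge0_integralZl//; last 2 first.
    - by move=> t _; rewrite lee_fin mulr_ge0.
    - by rewrite lee_fin ltW.
    by rewrite EFinM lee_wpmul2l// lee_fin ltW.
  apply: (@le_trans _ _ (\int[mu]_t ((E * z / 2)%:E * (fbm_q H W t w)%:E + (F t)%:E))%E).
    apply: ge0_le_lower_integral => t _.
      by rewrite lee_fin (mulr_ge0 (ltW E0))// mulr_ge0.
    by rewrite -!EFinM -EFinD lee_fin.
  rewrite ge0_integralD//; last 4 first.
  - by move=> t _; rewrite -EFinM lee_fin mulr_ge0.
  - exact: measurable_funeM.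
  - by move=> t _; rewrite lee_fin.
  - by apply/measurable_EFinP; exact: mF.
  rewrite ge0_integralZl//; last first.
    by move=> t _; rewrite lee_fin.
  by rewrite q1 mule1.
apply: le_trans FG; move: key; rewrite -/E.
case: (integral _ _ _) => [x| |] //; last by move=> _; rewrite leey.
rewrite -EFinD !lee_fin => h.
have : E * 2 <= E * z by rewrite ler_wpM2l// ltW.
by move: h; move: (E * z) => y h1 h2; lra.
Qed.

End pitman_bound.

(** * Exchange of expectation with two integrals *)

Section tonelli3.
Local Open Scope ereal_scope.
Context {d0 d1 d2} {T0 : measurableType d0} {T1 : measurableType d1}
  {T2 : measurableType d2} {R : realType}.
Variables (P : probability T0 R) (m1 : {sigma_finite_measure set T1 -> \bar R})
  (m2 : {sigma_finite_measure set T2 -> \bar R}).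

(** Tonelli twice: first the expectation passes the integral in [t], then, for each fixed [t], the
    one in [s]. This puts it innermost, where the kernel estimate applies. *)
Lemma tonelli3_cst_lty (c : R) (f : T0 * T1 * T2 -> \bar R) : (0 <= c)%R ->
  measurable_fun setT f -> (forall z, 0 <= f z) ->
  \int[m1]_t \int[m2]_s \int[P]_w f (w, t, s) < +oo ->
  \int[P]_w (c%:E + \int[m1]_t \int[m2]_s f (w, t, s)) < +oo.
Proof.
move=> c0 mf f0 fy.
pose F (y : T0 * T1) := \int[m2]_s f (y, s).
have mF : measurable_fun setT F.
  exact: (@measurable_fun_fubini_tonelli_F _ _ _ _ _ m2 f mf f0).
have F0 y : 0 <= F y by exact: integral_ge0.
have mG : measurable_fun setT (fun w => \int[m1]_t F (w, t)).
  exact: (@measurable_fun_fubini_tonelli_F _ _ _ _ _ m1 F mF F0).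
rewrite (ge0_integralD _ measurableT)//; last first.
  by move=> w _; apply: integral_ge0 => t _; exact: F0.
rewrite integral_cst// [X in (_ * X)%E](@probability_setT _ _ _ P) mule1.
rewrite lte_add_pinfty ?ltry//.
rewrite (@fubini_tonelli _ _ _ _ _ P m1 F mF F0).
apply: le_lt_trans fy; apply: ge0_le_lower_integral => t _.
  exact: integral_ge0.
rewrite (@fubini_tonelli _ _ _ _ _ P m2 (fun y => f (y.1, t, y.2)))//.
apply: (measurableT_comp mf (g := fun y : T0 * T2 => (y.1, t, y.2))).
by do 2?apply: measurable_fun_pair.
Qed.

End tonelli3.

(** * Finiteness of an exponential moment *)

Section pitman_moment.
Context {R : realType} {d} {T : measurableType d} (P : probability T R).
Variables (H : R) (W : R -> T -> R).
Local Notation mu := (@lebesgue_measure R).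
Local Notation p := (2 * H).
Local Notation mR := (measurableTypeR R).
Hypothesis H0 : 0 < H.
Hypothesis H1 : H <= 1.
Hypothesis fbm : is_two_sided_fBm P H W.

Let mW : forall s, measurable_fun setT (W s).
Proof. by case: fbm. Qed.

Let cW : forall w, continuous (fun s => W s w).
Proof. by case: fbm => _ [_ []]. Qed.

Lemma measurable_signr : measurable_fun setT (@signr R).
Proof.
rewrite /signr; apply: measurable_fun_ifT => //.
by apply: measurable_fun_ler.
Qed.

Lemma measurable_pitman_kernel :
  measurable_fun setT (fun z : T * mR * mR => pitman_kernel H W z.1.2 z.2 z.1.1).
Proof.
have mlnZ (x : T * mR * mR -> R) : measurable_fun setT x ->
    measurable_fun setT (fun z => W (x z) z.1.1 - `|x z| `^ p / 2).
  move=> mx; apply: measurable_funB.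
    have mW2 := @measurable_continuous_process _ _ _ W mW cW.
    apply: (measurableT_comp mW2 (g := fun z => (x z, z.1.1))).
    by apply: measurable_fun_pair => //; exact: measurableT_comp.
  apply: measurable_funM => //.
  apply: (measurableT_comp (measurable_powR p) (g := fun z => `|x z|)).
  exact: measurableT_comp.
have m1 : measurable_fun setT (fun z : T * mR * mR => z.1.2 : R).
  exact: measurableT_comp.
have m2 : measurable_fun setT (fun z : T * mR * mR => z.2 : R).
  exact: measurable_snd.
have mu' : measurable_fun setT (fun z : T * mR * mR => signr z.1.2 * z.2).
  by apply: measurable_funM => //; exact: (measurableT_comp measurable_signr m1).
have mv : measurable_fun setT (fun z : T * mR * mR => z.1.2 - signr z.1.2 * z.2).
  exact: measurable_funB.
apply: measurableT_comp => //; apply: measurable_funB; first exact: mlnZ.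
apply: measurable_funM => //; apply: measurable_funD; exact: mlnZ.
Qed.

(** The integrand of the pathwise bound at [a = 1/128]; an indicator replaces the domain [[0, 1]],
    so that both integrals run over the whole line. *)
Let f (z : T * mR * mR) : \bar R :=
  (`|z.1.2| * expR (4 * (1 / 128) * `|z.1.2| `^ p) *
    (\1_(`[0, 1]%classic : set R) z.2 * pitman_kernel H W z.1.2 z.2 z.1.1))%:E.

Let f0 z : (0 <= f z)%E.
Proof.
rewrite lee_fin mulr_ge0// ?mulr_ge0//; exact: expR_ge0.
Qed.

Let mf : measurable_fun setT f.
Proof.
have m1 : measurable_fun setT (fun z : T * mR * mR => z.1.2 : R).
  exact: measurableT_comp.
have m2 : measurable_fun setT (fun z : T * mR * mR => z.2 : R).
  exact: measurable_snd.
apply/measurable_EFinP; apply: measurable_funM.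
  apply: measurable_funM; first exact: measurableT_comp.
  apply: measurableT_comp => //; apply: measurable_funM => //.
  apply: (measurableT_comp (measurable_powR p) (g := fun z : T * mR * mR => `|(z.1.2 : R)|)).
  exact: measurableT_comp.
apply: measurable_funM; last exact: measurable_pitman_kernel.
apply: (measurableT_comp _ m2); exact: measurable_indic.
Qed.

Let integral_f w : (\int[mu]_t ((`|t| * expR (4 * (1 / 128) * `|t| `^ p))%:E *
      \int[mu]_(s in `[0%R, 1%R]) (pitman_kernel H W t s w)%:E) =
  \int[mu]_t \int[mu]_s f (w, t, s))%E.
Proof.
apply: eq_integral => t _; rewrite /f/=.
have mK : measurable_fun setT (fun s : mR =>
    (\1_(`[0, 1]%classic : set R) s * pitman_kernel H W t s w)%:E).
  apply/measurable_EFinP; apply: measurable_funM; first exact: measurable_indic.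
  apply: (measurableT_comp measurable_pitman_kernel (g := fun s : mR => (w, t, s))).
  by do 2?apply: measurable_fun_pair.
under [RHS]eq_integral do rewrite EFinM.
rewrite ge0_integralZl//; last first.
  by move=> s _; rewrite lee_fin mulr_ge0//; exact: expR_ge0.
congr (_ * _)%E; rewrite [LHS]integral_mkcond; congr integral; apply/funext => s.
by rewrite patchE indicE; case: ifP => _; rewrite ?mul1r ?mul0r.
Qed.

Let integral_f_lty : (\int[mu]_t \int[mu]_s \int[P]_w f (w, t, s) < +oo)%E.
Proof.
pose g (t : R) := (`|t| * expR (- (`|t| `^ p / 32)))%:E.
have g0 t : (0 <= g t)%E by rewrite lee_fin mulr_ge0// expR_ge0.
have mg : measurable_fun setT g.
  apply/measurable_EFinP; apply: measurable_funM => //.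
  apply: measurableT_comp => //; apply: measurableT_comp => //.
  apply: measurable_funM => //.
  exact: (measurableT_comp (measurable_powR p) (@normr_measurable R setT)).
apply: (@le_lt_trans _ _ (\int[mu]_t ((expR 2)%:E * g t))%E); last first.
  rewrite ge0_integralZl// lte_mul_pinfty// ?lee_fin ?expR_ge0//.
  by apply: integral_expR_powR_lty; rewrite mulr_gt0.
apply: ge0_le_lower_integral => t _.
  by apply: integral_ge0 => s _; exact: integral_ge0.
have ms : measurable_fun setT (fun s : R => (\1_(`[0, 1]%classic : set R) s)%:E : \bar R).
  by apply/measurable_EFinP; exact: measurable_indic.
have -> : ((expR 2)%:E * g t = \int[mu]_s ((expR 2)%:E * g t *
    (\1_(`[0, 1]%classic : set R) s)%:E))%E.
  rewrite ge0_integralZl//; last by rewrite mule_ge0// lee_fin expR_ge0.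
  rewrite integral_indic//= setIT lebesgue_measure_itv/=.
  by rewrite lte_fin ltr01 -EFinD subr0 mule1.
apply: ge0_le_lower_integral => s _; first exact: integral_ge0.
have [s01|s01] := boolP (s \in (`[0, 1]%classic : set R)); last first.
  rewrite integral0_eq => [|w _]; first by rewrite !mule_ge0// lee_fin expR_ge0.
  by rewrite /f/= indicE (negbTE s01) mul0r mulr0.
rewrite /f indicE s01 mule1.
under eq_integral do rewrite /= !mul1r EFinM.
have s01' : 0 <= s <= 1 by move: s01; rewrite inE/= in_itv.
rewrite ge0_integralZl//; last 2 first.
- apply/measurable_EFinP.
  apply: (measurableT_comp measurable_pitman_kernel (g := fun w : T => (w, t, s))).
  by do 2?apply: measurable_fun_pair.
- by move=> w _; rewrite lee_fin; exact: expR_ge0.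
apply: (le_trans (lee_wpmul2l _ (pitman_kernel_expectation P H W H0 fbm t s s01'))).
  by rewrite lee_fin mulr_ge0// expR_ge0.
(* The weight grows with rate [4 / 128 = 1/32] and the kernel decays with rate 1/16, which leaves
   the decay 1/32 of [g]. *)
rewrite -!EFinM lee_fin -[leLHS]mulrA [leRHS]mulrCA ler_wpM2l// -!expRD ler_expR.
by move: (`|t| `^ p) => x; lra.
Qed.

Lemma expR_pitman_zeta_lty :
  (\int[P]_w (expR (1 / 128 * `|pitman_zeta H W w| `^ p))%:E < +oo)%E.
Proof.
apply: (@le_lt_trans _ _ (\int[P]_w ((expR (4 * (1 / 128)))%:E +
    \int[mu]_t \int[mu]_s f (w, t, s)))%E).
  apply: ge0_le_lower_integral => w _; first by rewrite lee_fin expR_ge0.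
  rewrite -integral_f; apply: expR_pitman_zeta_le => //.
exact (tonelli3_cst_lty P mu mu _ _ (expR_ge0 _) mf f0 integral_f_lty).
Qed.

End pitman_moment.

(** * The threshold and all smaller exponents *)

Theorem theorem1 (R : realType) (H : R) (hH : 0 < H <= 1) :
  exists alpha : R, 0 < alpha /\
    forall (d : measure_display) (T : measurableType d) (P : probability T R)
           (W : R -> T -> R),
      is_two_sided_fBm P H W ->
      forall delta : R, delta < alpha ->
        (\int[P]_w (expR (delta * `|pitman_zeta H W w| `^ (2 * H)))%:E < +oo)%E.
Proof.
(* One constant serves every [H], with [4 / 128 < 1/16]. Smaller [delta], negative ones included,
   follow by monotonicity because [|zeta|^(2 H) >= 0]. *)
have /andP[H0 H1] := hH; exists (1 / 128); split => [//|d T P W fbm delta hd].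
apply: (@le_lt_trans _ _
    (\int[P]_w (expR (1 / 128 * `|pitman_zeta H W w| `^ (2 * H)))%:E)%E).
  apply: ge0_le_lower_integral => w _; first by rewrite lee_fin expR_ge0.
  by rewrite lee_fin ler_expR ler_wpM2r ?powR_ge0// ltW.
exact: expR_pitman_zeta_lty.
Qed.
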